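(* Let $R$ be a commutative ring with nonzero identity, $I$ an ideal of $R$, $M$ a finitely generated faithful multiplication $R$-module and $P$ a proper submodule of $M$ with $(IP:M)=I(P:M)$. Then $P$ is an $I$-primary submodule of $M$ if and only if $(P:M)$ is an $I$-primary ideal of $R$.
   Context: Modules are unitary. An $R$-module $M$ is a multiplication module if every submodule $N$ of $M$ has the form $N=AM$ for some ideal $A$ of $R$; it is faithful if its annihilator is zero. For a submodule $P$ of $M$, $(P:M)=\{r\in R : rM\subseteq P\}$. For an ideal $A$ of $R$, $\sqrt{A}=\{a\in R : a^n\in A \text{ for some positive integer } n\}$. A proper submodule $P$ of $M$ is called an $I$-primary submodule of $M$ if for all $r\in R$ and $m\in M$, $rm\in P\setminus IP$ implies $m\in P$ or $r\in\sqrt{(P:M)}$. An $I$-primary ideal of $R$ is an $I$-primary submodule of the $R$-module $R$, i.e. a proper ideal $Q$ such that for all $a,b\in R$, $ab\in Q\setminus IQ$ implies $a\in Q$ or $b\in\sqrt{Q}$. *)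

(* Defs.v *)
From mathcomp Require Import all_boot all_algebra.
From mathcomp Require Import boolp classical_sets.

Set Implicit Arguments.
Unset Strict Implicit.
Unset Printing Implicit Defensive.

Import GRing.Theory.

Local Open Scope classical_set_scope.
Local Open Scope ring_scope.

Section Definitions.
Variable R : comNzRingType.

(* Subsets are Prop-valued ([set M]), so that submodules and ideals range over
   all subsets, not only the decidable ones. *)
Definition submodule (M : lmodType R) (N : set M) : Prop := submod_closed (mem N).

(* The regular module R^o has carrier R; its submodules are the ideals of R. *)
Definition ideal (A : set R) : Prop := submodule (A : set R^o).

(* The product AN: finite sums of elements a *: x with a in A and x in N. *)
Definition ideal_mul (M : lmodType R) (A : set R) (N : set M) : set M :=
  [set x | exists (n : nat) (a : 'I_n -> R) (y : 'I_n -> M),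
     [/\ forall i, A (a i), forall i, N (y i) & x = \sum_(i < n) a i *: y i]].

(* (N : M) *)
Definition colon (M : lmodType R) (N : set M) : set R :=
  [set r | forall m : M, N (r *: m)].

Definition radical (A : set R) : set R :=
  [set a | exists2 n : nat, (0 < n)%N & A (a ^+ n)].

Definition annihilator (M : lmodType R) : set R :=
  [set r | forall m : M, r *: m = 0].

Definition faithful (M : lmodType R) : Prop := annihilator M = [set 0].

Definition finitely_generated (M : lmodType R) : Prop :=
  exists (n : nat) (g : 'I_n -> M),
    forall m : M, exists c : 'I_n -> R, m = \sum_(i < n) c i *: g i.

Definition multiplication_module (M : lmodType R) : Prop :=
  forall N : set M, submodule N ->
    exists2 A : set R, ideal A & N = ideal_mul A [set: M].

Definition proper_submodule (M : lmodType R) (N : set M) : Prop :=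
  submodule N /\ N <> [set: M].

Definition primary_submodule (I : set R) (M : lmodType R) (P : set M) : Prop :=
  proper_submodule P /\
  forall (r : R) (m : M), (P `\` ideal_mul I P) (r *: m) ->
    P m \/ radical (colon P) r.

Definition primary_ideal (I Q : set R) : Prop :=
  primary_submodule I (Q : set R^o).

Lemma colon_regular (Q : set R) : ideal Q -> colon (Q : set R^o) = Q.
Proof.
move=> [_ lQ]; apply/seteqP; split=> r /=.
  by move=> /(_ (1 : R^o)); rewrite /GRing.scale /= mulr1.
move=> Qr m.
have Q0 : (0 : R^o) \in mem (Q : set R^o).
  have /= := lQ (-1) (r : R^o) (r : R^o).
  by rewrite scaleN1r addNr; apply; apply/mem_set.
have /= := lQ m (r : R^o) 0.
rewrite addr0 => /(_ _ Q0) H; move: (H (mem_set Qr)) => /set_mem.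
by rewrite /GRing.scale /= mulrC.
Qed.

Lemma primary_idealP (I Q : set R) :
  primary_ideal I Q <->
  [/\ ideal Q, Q <> [set: R] &
      forall a b : R, (Q `\` ideal_mul I (Q : set R^o)) (a * b) ->
        Q a \/ radical Q b].
Proof.
split.
  move=> [[iQ pQ] H]; split=> // a b Qab.
  by have := H b (a : R^o); rewrite colon_regular //; apply; rewrite /GRing.scale /= mulrC.
move=> [iQ pQ H]; split=> // r m Qrm; rewrite colon_regular //.
by apply: H; rewrite mulrC.
Qed.

End Definitions.

(* Main.v *)
(** Both directions rest on the fact that a group is never the union of two
    proper subgroups.  If P is I-primary, [ab] lies in (P:M) and [b] is not in
    its radical, then M is covered by {m | abm in IP} and {m | am in P}; the
    first is all of M only if [ab] is in (IP:M) = I(P:M).  Conversely, if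
    [rm] is in P and [r] is not in the radical of (P:M), write Rm = AM; then A
    is covered by {a | ra in I(P:M)} and (P:M), and A inside the first would
    give [rm] in I(P:M)M, hence in IP. *)

Require Import Defs.
From mathcomp Require Import all_boot all_algebra.
From mathcomp Require Import boolp classical_sets.

Set Implicit Arguments.
Unset Strict Implicit.
Unset Printing Implicit Defensive.

Import GRing.Theory.

Local Open Scope classical_set_scope.
Local Open Scope ring_scope.

Section Submodules.
Variables (R : comNzRingType) (M : lmodType R).
Implicit Types (N : set M) (A : set R).

Lemma submoduleP N :
  submodule N <->
  N 0 /\ forall (a : R) x y, N x -> N y -> N (a *: x + y).
Proof.
split=> -[N0 NL]; split.
- exact: set_mem N0.
- by move=> a x y Nx Ny; apply/set_mem/NL; apply/mem_set.
- exact: mem_set N0.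
- by move=> a x y /set_mem Nx /set_mem Ny; apply/mem_set/NL.
Qed.

Lemma submodule0 N : submodule N -> N 0.
Proof. by case/submoduleP. Qed.

Lemma submoduleD N x y : submodule N -> N x -> N y -> N (x + y).
Proof. by case/submoduleP=> _ NL Nx Ny; rewrite -[x]scale1r; apply: NL. Qed.

Lemma submoduleZ N (a : R) x : submodule N -> N x -> N (a *: x).
Proof. by case/submoduleP=> N0 NL Nx; rewrite -[a *: x]addr0; apply: NL. Qed.

Lemma submoduleB N x y : submodule N -> N x -> N y -> N (x - y).
Proof.
by move=> sN Nx Ny; rewrite -scaleN1r; apply: submoduleD => //; apply: submoduleZ.
Qed.

Lemma submodule_setT : submodule [set: M].
Proof. exact/submoduleP. Qed.

Lemma submodule_cyclic (m : M) : submodule [set r *: m | r in [set: R]].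
Proof.
apply/submoduleP; split; first by exists 0; rewrite ?scale0r.
by move=> a _ _ [r _ <-] [s _ <-]; exists (a * r + s); rewrite // scalerDl scalerA.
Qed.

(** Supplies the covering pieces: subsets of [M] in one direction and, taken over [R^o], of the ring
    in the other. *)
Lemma submodule_scale_preim N (r : R) :
  submodule N -> submodule [set x | N (r *: x)].
Proof.
move=> sN; apply/submoduleP; split=> [|a x y] /=.
  by rewrite scaler0; apply: submodule0.
move=> Nx Ny; rewrite scalerDr scalerA mulrC -scalerA.
by apply: submoduleD => //; apply: submoduleZ.
Qed.

(** Fix [x] in [N] outside [N1], hence in [N2]. If [y] lies in [N1], then [x + y] cannot, so it lies
    in [N2], and subtracting [x] puts [y] there too. *)
Lemma submodule_cover N N1 N2 :
  submodule N -> submodule N1 -> submodule N2 ->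
  N `<=` N1 `|` N2 -> N `<=` N1 \/ N `<=` N2.
Proof.
move=> sN sN1 sN2 cov; have [?|] := pselect (N `<=` N1); first by left.
move=> /existsNP[x /not_implyP[Nx N1x]]; right=> y Ny.
have [N1y|//] := cov y Ny; have [//|N2x] := cov x Nx.
have [N1xy|N2xy] := cov (x + y) (submoduleD sN Nx Ny).
  by case: N1x; rewrite -(addrK y x); apply: submoduleB.
by rewrite -(addKr x y) addrC; apply: submoduleB.
Qed.

End Submodules.

Section IdealProducts.
Variables (R : comNzRingType) (M : lmodType R).
Implicit Types (N : set M) (A : set R).

Lemma ideal_colon N : submodule N -> ideal (colon N).
Proof.
move=> sN; apply/submoduleP; split=> [m|a r s Nr Ns m].
  by rewrite scale0r; apply: submodule0.
rewrite scalerDl; apply: submoduleD => //.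
by rewrite -scalerA; apply: submoduleZ.
Qed.

Lemma ideal_mul_in A N (a : R) x : A a -> N x -> ideal_mul A N (a *: x).
Proof.
by move=> Aa Nx; exists 1%N, (fun=> a), (fun=> x); split; rewrite ?big_ord1.
Qed.

Lemma ideal_mul_sub A N N' : submodule N' ->
  (forall a x, A a -> N x -> N' (a *: x)) -> ideal_mul A N `<=` N'.
Proof.
move=> sN' AN x [n [a [y [Aa Ny ->]]]].
by apply: big_ind => [|u v|i _]; [exact: submodule0|exact: submoduleD|exact: AN].
Qed.

(** Two finite sums are concatenated along [split]; the scalar [c] is absorbed into the
    coefficients, which stay in the ideal [A]. *)
Lemma submodule_ideal_mul A N : ideal A -> submodule (ideal_mul A N).
Proof.
move=> iA; apply/submoduleP; split.
  by exists 0%N, (fun=> 0), (fun=> 0); split=> [[]|[]|] //; rewrite big_ord0.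
move=> c x y [n [a [u [Aa Nu ->]]]] [p [b [v [Ab Nv ->]]]].
exists (n + p)%N,
  (fun i => match split i with inl j => c * a j | inr k => b k end),
  (fun i => match split i with inl j => u j | inr k => v k end).
split=> [i|i|].
- by case: (split i) => [j|//]; apply: (submoduleZ (M := R^o)).
- by case: (split i).
rewrite scaler_sumr big_split_ord /=; congr (_ + _); apply: eq_bigr => i _.
  by rewrite -[lshift p i]/(unsplit (inl i)) unsplitK scalerA.
by rewrite -[rshift n i]/(unsplit (inr i)) unsplitK.
Qed.

End IdealProducts.

Theorem theorem2p12 (R : comNzRingType) (I : set R) (hI : ideal I)
    (M : lmodType R) (hfg : finitely_generated M) (hfaith : faithful M)
    (hmult : multiplication_module M)
    (P : set M) (hP : proper_submodule P)
    (hcolon : colon (ideal_mul I P) = ideal_mul (M := R^o) I (colon P)) :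
  primary_submodule I P <-> primary_ideal I (colon P).
Proof.
have [sP PT] := hP.
have sIP : submodule (ideal_mul I P) by apply: submodule_ideal_mul.
have iQ : ideal (colon P) by apply: ideal_colon.
split=> [[_ primP]|/primary_idealP[_ _ primQ]].
- apply/primary_idealP; split=> // [QT|a b [Qab]].
    apply: PT; apply/seteqP; split=> // m _.
    have Q1 : colon P 1 by rewrite QT.
    by rewrite -[m]scale1r; apply: Q1.
  (* Read in [(IP:M)], the hypothesis says that [a * b] sends some vector outside [IP], so the first
     piece of the cover is not all of [M]. *)
  rewrite -hcolon => IPab.
  have [|nradb] := pselect (radical (colon P) b); first by right.
  have [m _|abM|aM] := submodule_cover (@submodule_setT R M)
    (submodule_scale_preim (a * b) sIP) (submodule_scale_preim a sP).
  + have [|IPabm] := pselect (ideal_mul I P ((a * b) *: m)); first by left.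
    (* The scalar is [b] and the vector [a *: m]; as [b] is not in the radical, [a *: m] must be in
       [P]. *)
    right; have [|//|//] := primP b (a *: m).
    by rewrite scalerA mulrC; split=> //; apply: Qab.
  + by case: IPab => m; apply: abM.
  + by left=> m; apply: aM.
- split=> // r m [Prm IPrm].
  have [|nradr] := pselect (radical (colon P) r); first by right.
  left; have [A iA AM] := hmult _ (submodule_cyclic m).
  have Am : ideal_mul A [set: M] m by rewrite -AM; exists 1; rewrite ?scale1r.
  (* Since [AM = Rm], each [a *: y] is some [s *: m], and [r] sends it to [s *: (r *: m)], which is
     in [P]. *)
  have QA a : A a -> colon P (r * a).
    move=> Aa y; have : ideal_mul A [set: M] (a *: y) by apply: ideal_mul_in.
    rewrite -AM => -[s _ asy]; rewrite -scalerA -asy scalerA mulrC -scalerA.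
    exact: submoduleZ.
  have sIQ : ideal (ideal_mul (M := R^o) I (colon P)) by apply: submodule_ideal_mul.
  have [a Aa|rA|AQ] := submodule_cover iA
    (submodule_scale_preim (M := R^o) r sIQ) iQ.
  + have [|IQra] := pselect (ideal_mul (M := R^o) I (colon P) (r * a)); first by left.
    right; have [|//|//] := primQ a r.
    by rewrite mulrC; split=> //; apply: QA.
  (* Generalising [m] to all of [AM] reduces the claim to the generators [a *: y], where [r * a]
     lies in [I(P:M) = (IP:M)]. *)
  + case: IPrm; move: m Am {AM Prm}.
    apply: ideal_mul_sub; first exact: submodule_scale_preim.
    move=> a y /rA IQra _ /=; rewrite scalerA.
    by move: IQra; rewrite /= -hcolon; apply.
  (* Here [A] lies in [(P:M)], so [m] belongs to [AM], which is inside [P]. *)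
  + apply: ideal_mul_sub Am => // a y /AQ Qa _; exact: Qa.
Qed.
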